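(* If $G=(V,E)$ is a connected $2$-distance graph, then $\omega(G) \leq |V| - 3$.
   Context: Graphs are finite, simple and undirected; $d_H(u,v)$ denotes geodesic distance (length of a shortest path) in $H$. The $2$-distance operator $D^2$ sends a graph $H$ to the graph $D^2(H)$ on the same vertex set in which $u,v$ are adjacent if and only if $d_H(u,v)=2$. A graph $G$ is a $2$-distance graph if there exists a graph $H$ with $G \cong D^2(H)$. $\omega(G)$ is the clique number of $G$, the size of a largest clique in $G$.
   Formalization: The graph G is additionally assumed to have at least two vertices, because the claim fails for the one-vertex graph (connected, equal to its own 2-distance graph, with clique number 1 > 1 − 3) and for the empty graph. *)

(* Defs.v *)
From mathcomp Require Import all_boot.

Set Implicit Arguments.
Unset Strict Implicit.
Unset Printing Implicit Defensive.

Record sgraph := SGraph {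
  vertex :> finType;
  adj : rel vertex;
  adj_sym : symmetric adj;
  adj_irr : irreflexive adj }.

Definition connected (G : sgraph) : Prop :=
  forall u v : G, connect (@adj G) u v.

Definition iso (G H : sgraph) : Prop :=
  exists2 f : G -> H, bijective f & forall u v, adj (f u) (f v) = adj u v.

Definition has_path (G : sgraph) (u v : G) (k : nat) : bool :=
  [exists p : k.-tuple G,
     [&& path (@adj G) u p, uniq (u :: p) & last u p == v]].

(* None encodes infinite distance.  A path visits at most #|G| vertices, so  *)
(* only lengths k < #|G| need be searched.                                   *)
Definition dist (G : sgraph) (u v : G) : option nat :=
  ohead [seq k <- iota 0 #|G| | has_path u v k].

Lemma has_path_sym (G : sgraph) (u v : G) k : has_path u v k = has_path v u k.
Proof.
suff imp (x y : G) : has_path x y k -> has_path y x k by apply/idP/idP; apply: imp.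
case/existsP=> p /and3P[xp Up /eqP lp].
have sz : size (rev (belast x p)) == k by rewrite size_rev size_belast size_tuple.
have E : y :: rev (belast x p) = rev (x :: p) by rewrite [in RHS]lastI rev_rcons lp.
apply/existsP; exists (Tuple sz); rewrite -[tval _]/(rev (belast x p)).
apply/and3P; split.
- rewrite -lp rev_path; apply: sub_path xp => a b /=; by rewrite adj_sym.
- by rewrite E rev_uniq.
- by rewrite -[last _ _]/(last y (y :: rev (belast x p))) E rev_cons last_rcons.
Qed.

Lemma dist_sym (G : sgraph) (u v : G) : dist u v = dist v u.
Proof. by rewrite /dist (eq_filter (has_path_sym u v)). Qed.

Lemma dist_refl (G : sgraph) (u : G) : dist u u = Some 0.
Proof.
have: 0 < #|G| by apply/card_gt0P; exists u.
rewrite /dist; case: #|G| => // n _ /=.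
suff -> : has_path u u 0 by [].
by apply/existsP; exists [tuple]; rewrite /= eqxx.
Qed.

Definition D2_adj (G : sgraph) : rel G := fun u v => dist u v == Some 2.

Lemma D2_sym (G : sgraph) : symmetric (@D2_adj G).
Proof. by move=> u v; rewrite /D2_adj dist_sym. Qed.

Lemma D2_irr (G : sgraph) : irreflexive (@D2_adj G).
Proof. by move=> u; rewrite /D2_adj dist_refl. Qed.

Definition D2 (H : sgraph) : sgraph := SGraph (@D2_sym H) (@D2_irr H).

Definition two_distance_graph (G : sgraph) : Prop :=
  exists H : sgraph, iso G (D2 H).

Definition clique (G : sgraph) (A : {set G}) : bool :=
  [forall u in A, forall v in A, (u != v) ==> adj u v].

Definition clique_number (G : sgraph) : nat :=
  \max_(A : {set G} | clique A) #|A|.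

(* Main.v *)
Require Import Defs.
From mathcomp Require Import all_boot.

(** Let [G] be the 2-distance graph of [H] and [A] a clique of [G], so that [A]
    is independent in [H].  By connectedness some [G]-edge [a x] leaves [A]; a
    common [H]-neighbour [y] of [a] and [x] lies outside [A].  If [x] and [y]
    were the only vertices outside [A], then [y], not being [G]-adjacent to
    [x], would have a [G]-neighbour [b] in [A], at distance two through [x].
    Now [a] sees only [y] and [b] sees only [x], so [a] and [b] have no common
    [H]-neighbour, although both belong to the clique [A]. *)

Lemma D2_adjP (H : sgraph) (u v : H) :
  D2_adj u v -> [/\ u != v, ~~ adj u v & exists2 w, adj u w & adj w v].
Proof.
move=> /eqP duv.
have neq_uv : u != v by apply: contra_eq_neq duv => ->; rewrite dist_refl.
set s := [seq k <- iota 0 #|H| | has_path u v k].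
have [r Es] : exists r, s = 2 :: r.
  by move: duv; rewrite /dist -/s; case: s => [|k r] //= [->]; exists r.
have s_sorted : sorted ltn s.
  by apply: sorted_filter; [exact: ltn_trans | exact: iota_ltn_sorted].
split=> //.
  apply/negP=> uv.
  (* [s] is increasing with head 2, so an edge between [u] and [v] would put the smaller length 1 in
     it. The search range contains 1 because [u] and [v] are two distinct vertices. *)
  have: 1 \in s.
    rewrite mem_filter mem_iota /= add0n; apply/andP; split.
      by apply/existsP; exists [tuple v]; rewrite /= uv inE neq_uv eqxx.
    by apply/card_gt1P; exists u, v.
  rewrite Es inE /= => r1.
  move: s_sorted; rewrite Es /= (path_sortedE ltn_trans).
  by case/andP=> /allP /(_ _ r1).
have: 2 \in s by rewrite Es mem_head.
rewrite mem_filter => /andP[/existsP[p /and3P[]]].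
case: p => -[|w [|v' [|]]] //= _ /and3P[uw wv' _] _ /eqP <- _.
by exists w.
Qed.

Lemma connected_neighbor (G : sgraph) (u : G) :
  1 < #|G| -> connected G -> exists v, adj u v.
Proof.
move=> G_gt1 Gconn.
have [v neq_vu] : exists v, v != u.
  by case/card_gt1P: G_gt1 => x [y [_ _ neq_xy]]; have [Exu|] := eqVneq x u;
    [exists y; rewrite -Exu eq_sym | exists x].
have /connectP[[|w p] /=] := Gconn u v; first by move=> _ Evu; rewrite Evu eqxx in neq_vu.
by case/andP=> uw _ _; exists w.
Qed.

(** Otherwise [A] would be closed under adjacency, hence a union of components, and could not
    separate [a] from [x]. *)
Lemma connected_crossing (G : sgraph) (A : {set G}) (a x : G) :
  connected G -> a \in A -> x \notin A ->
  exists u v, [/\ u \in A, v \notin A & adj u v].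
Proof.
move=> Gconn aA xA; have [/existsP[u /existsP[v /and3P[]]]|noE] :=
  boolP [exists u, exists v, [&& u \in A, v \notin A & adj u v]].
  by exists u, v.
have out u v : adj u v -> u \in A -> v \in A.
  move=> uv uA; apply: contraNT noE => vA.
  by apply/existsP; exists u; apply/existsP; exists v; apply/and3P.
have Aclosed : closed (@adj G) (mem A).
  by move=> u v uv; apply/idP/idP; apply: out; rewrite // adj_sym.
by have := closed_connect Aclosed (Gconn a x); rewrite /= aA (negPf xA).
Qed.

Lemma iso_connected (G H : sgraph) : iso G H -> connected G -> connected H.
Proof.
case=> f [g _ gK] f_adj Gconn u v.
rewrite -(gK u) -(gK v); have /connectP[p] := Gconn (g u) (g v).
elim: p (g u) => [|w p IHp] x /=; first by move=> _ ->; exact: connect0.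
case/andP=> xw wp last_p; apply: connect_trans (IHp _ wp last_p).
by apply: connect1; rewrite f_adj.
Qed.

Lemma iso_clique (G H : sgraph) (f : G -> H) (A : {set G}) :
  (forall u v, adj (f u) (f v) = adj u v) -> clique A -> clique (f @: A).
Proof.
move=> f_adj /forall_inP cliqueA.
apply/forall_inP=> _ /imsetP[u uA ->]; apply/forall_inP=> _ /imsetP[v vA ->].
apply/implyP=> neq_fuv; rewrite f_adj.
have /forall_inP/(_ v vA)/implyP := cliqueA u uA; apply.
by apply: contraNneq neq_fuv => ->.
Qed.

Lemma card_ge3 (T : finType) (A : {set T}) (x y z : T) :
  uniq [:: x; y; z] -> x \in A -> y \in A -> z \in A -> 3 <= #|A|.
Proof.
move=> Uxyz xA yA zA; rewrite -[3]/(size [:: x; y; z]) -(card_uniqP Uxyz).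
by apply/subset_leq_card/subsetP=> t; rewrite !inE => /or3P[] /eqP ->.
Qed.

Lemma clique_D2_complement (H : sgraph) (A : {set D2 H}) :
  1 < #|H| -> connected (D2 H) -> clique A -> 3 <= #|~: A|.
Proof.
move=> H_gt1 D2conn /forall_inP cliqueA.
have D2nbr (u : H) : exists v, D2_adj u v.
  by apply: (@connected_neighbor (D2 H)).
have adj_neq (u v : H) : adj u v -> u != v.
  by apply: contraTneq => ->; rewrite adj_irr.
have AD2 (u v : H) : u \in A -> v \in A -> u != v -> D2_adj u v.
  by move=> uA vA; have /forall_inP/(_ v vA)/implyP := cliqueA u uA.
have A_indep (u v : H) : u \in A -> adj u v -> v \notin A.
  move=> uA uv; apply/negP=> vA.
  by have [_] := D2_adjP _ _ _ (AD2 u v uA vA (adj_neq u v uv)); rewrite uv.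
(* For empty [A] it suffices to find three vertices: two at distance two and their common
   neighbour. *)
have [A0|[a0 a0A]] := set_0Vmem A.
  have /card_gt0P[u _] := ltnW H_gt1.
  have [v /D2_adjP[neq_uv _ [w uw wv]]] := D2nbr u.
  apply: (@card_ge3 H _ u v w); rewrite ?A0 ?inE //=.
  by rewrite !inE negb_or neq_uv (adj_neq _ _ uw) eq_sym (adj_neq _ _ wv).
(* By independence of [A] in [H], such a [c] lies outside [A], so a crossing edge of [D2 H]
   exists. *)
have [c a0c] : exists c, @adj H a0 c.
  by have [b /D2_adjP[_ _ [c]]] := D2nbr a0; exists c.
have [a [x [aA xA /D2_adjP[_ nax [y ay yx]]]]] :=
  connected_crossing _ _ _ _ D2conn a0A (A_indep _ _ a0A a0c).
have yA := A_indep _ _ aA ay.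
rewrite leqNgt; apply/negP=> compl_lt3.
have outA (z : H) : z \notin A -> z = x \/ z = y.
  move=> zA; have [->|nzx] := eqVneq z x; first by left.
  have [->|nzy] := eqVneq z y; first by right.
  case/negP: (negbT (ltn_geF compl_lt3)).
  apply: (@card_ge3 H _ z x y); rewrite ?inE //=.
  by rewrite !inE negb_or nzx nzy eq_sym (adj_neq _ _ yx).
have [b /D2_adjP[neq_yb nyb [z yz zb]]] := D2nbr y.
have bA : b \in A.
  apply: contraT => /outA[Eb|Eb]; first by rewrite Eb yx in nyb.
  by rewrite Eb eqxx in neq_yb.
(* In [H], [y] is adjacent to [a] but at distance two from [b]. *)
have neq_ab : a != b by apply: contraNneq nyb => <-; rewrite adj_sym.
have [_ _ [w aw wb]] := D2_adjP _ _ _ (AD2 a b aA bA neq_ab).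
(* Neither candidate for [w] works: [x] is at distance two from [a], and [y] from [b]. *)
have [Ew|Ew] := outA w (A_indep _ _ aA aw).
  by rewrite Ew (negPf nax) in aw.
by rewrite Ew (negPf nyb) in wb.
Qed.

(** The one-vertex graph is connected and is its own 2-distance graph, yet violates the bound;
    [Gnontriv] excludes it and the empty graph. Adding 3 on the left avoids truncated
    subtraction. *)
Theorem proposition1 (G : sgraph) (Gnontriv : 1 < #|G|) (Gconn : connected G)
  (G2dist : two_distance_graph G) : clique_number G + 3 <= #|G|.
Proof.
have [H isoGH] := G2dist; have D2conn := iso_connected _ _ isoGH Gconn.
have [f f_bij f_adj] := isoGH.
have cardGH : #|G| = #|H| := bij_eq_card f_bij.
have bound (A : {set G}) : clique A -> #|A| + 3 <= #|G|.
  move=> cliqueA.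
  have := clique_D2_complement H (f @: A).
  rewrite -cardGH => /(_ Gnontriv D2conn (iso_clique _ _ _ _ f_adj cliqueA)).
  have := cardsC (f @: A); rewrite (card_imset _ (bij_inj f_bij)).
  by rewrite -[#|D2 H|]/#|H| -cardGH => <-; rewrite leq_add2l.
(* The default value 0 of the maximum needs [3 <= #|G|], which is the bound for the empty clique. *)
apply: (big_ind (fun n => n + 3 <= #|G|)) => // [|m n m3 n3].
  apply: leq_trans (bound set0 _); first by rewrite leq_addl.
  by apply/forall_inP=> u; rewrite inE.
by rewrite addn_maxl geq_max m3.
Qed.
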